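(* Let $A$ be a Banach algebra and let $D:A\to A^*$ be a surjective bounded derivation. Suppose that its second adjoint $D'':A^{**}\to A^{***}$ is a derivation. Then: (1) $A^*$ has the $w^*wc$-property and $A^{**}$ has the $Lw^*wc$-property, with respect to $A$. (2) For every $a''\in A^{**}$, the mapping $x''\mapsto a''x''$ from $A^{**}$ into $A^{**}$ is weak$^*$-to-weak continuous. (3) $A$ is Arens regular. (4) If $A$ has a left bounded approximate identity, then $A$ is reflexive.
   Context: For $a,b\in A$, $a'\in A^*$: $\langle a'a,b\rangle=\langle a',ab\rangle$ and $\langle aa',b\rangle=\langle a',ba\rangle$. For $a''\in A^{**}$: $\langle a''a',a\rangle=\langle a'',a'a\rangle$, so $a''a'\in A^*$. $A^{**}$ is a Banach algebra under the first Arens product $\langle a''b'',a'\rangle=\langle a'',b''a'\rangle$, and $A^{***}$ is the dual Banach $A^{**}$-bimodule: $\langle x'''a'',b''\rangle=\langle x''',a''b''\rangle$, $\langle a''x''',b''\rangle=\langle x''',b''a''\rangle$. Spaces are identified with their canonical images in second duals; in particular $A^*\subseteq A^{***}$, and for $x'\in A^*$, $x'a''\in A^{***}$ is $\langle x'a'',x''\rangle=\langle a''x'',x'\rangle$. A derivation from a Banach algebra $C$ into a Banach $C$-bimodule $E$ is a bounded linear map $D$ with $D(xy)=xD(y)+D(x)y$. ''$D''$ is a derivation'' means that $D''(a''b'')=a''D''(b'')+D''(a'')b''$ for all $a'',b''\in A^{**}$, where $A^{**}$ carries the first Arens product and acts on $A^{***}$ by the dual module actions $\langle x'''a'',b''\rangle=\langle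 x''',a''b''\rangle$ and $\langle a''x''',b''\rangle=\langle x''',b''a''\rangle$. In the following, $a''\in A^{**}$ is arbitrary and $(a_\alpha)\subseteq A$ is any net with $a_\alpha\to a''$ weak$^*$ in $A^{**}$. $A^*$ has the $Lw^*wc$-property with respect to $A$ if always $x'a_\alpha\to x'a''$ weakly in $A^*$ for each $x'\in A^*$ (in particular $x'a''\in A^*$). $A^*$ has the $Rw^*wc$-property with respect to $A$ if always $a_\alpha x'\to a''x'$ weakly in $A^*$ for each $x'\in A^*$. $A^*$ has the $w^*wc$-property if it has both. $A^{**}$ has the $Lw^*wc$-property with respect to $A$ if always $x''a_\alpha\to x''a''$ weakly in $A^{**}$ for each $x''\in A^{**}$. $A$ is Arens regular if its two Arens products on $A^{**}$ coincide. A left bounded approximate identity is a bounded net $(e_\alpha)$ in $A$ with $e_\alpha a\to a$ for each $a\in A$. *)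

(* Defs.v *)
From HB Require Import structures.
From mathcomp Require Import all_boot all_order all_algebra.
From mathcomp Require Import complex.
From mathcomp Require Import all_classical all_reals all_analysis.

Set Implicit Arguments.
Unset Strict Implicit.
Unset Printing Implicit Defensive.

Import Order.TTheory GRing.Theory Num.Theory.
Import numFieldNormedType.Exports.

Local Open Scope classical_set_scope.
Local Open Scope ring_scope.

Variant scalar_kind := RealScalars | ComplexScalars.

Definition scalars (R : realType) (k : scalar_kind) : numFieldType :=
  match k with
  | RealScalars => R
  | ComplexScalars => R[i]
  end.

(* In [R[i]], [x <= y] means that [y - x] is real and nonnegative, so that all
   the elements of a bounded above set have the same imaginary part. *)
Lemma scalars_supremums (R : realType) (k : scalar_kind)
    (S : set (scalars R k)) :
  S !=set0 -> ubound S !=set0 -> supremums S !=set0.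
Proof.
case: k S => /= S [s Ss] [u uS].
  exists (sup S); split => [x Sx|x xS].
    by apply: ub_le_sup => //; exists u.
  by apply: ge_sup => //; exists s.
pose T : set R := [set complex.Re z | z in S].
have T0 : T !=set0 by exists (complex.Re s), s.
have imS z : S z -> complex.Im z = complex.Im u.
  by move=> /uS; rewrite lecE => /andP[/eqP ->].
have uT : ubound T (complex.Re u).
  by move=> _ [z Sz <-]; move: (uS _ Sz); rewrite lecE => /andP[].
exists (Complex (sup T) (complex.Im u)); split => [z Sz|v vS].
  rewrite lecE /= (imS _ Sz) eqxx /=.
  by apply: ub_le_sup; [exists (complex.Re u)|exists z].
have := vS _ Ss; rewrite !lecE /= (imS _ Ss) => /andP[-> _] /=.
apply: ge_sup => // _ [z Sz <-].
by have := vS _ Sz; rewrite lecE => /andP[].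
Qed.

(* No unit is assumed, unlike for the algebraic structures [algType]. *)
HB.mixin Record NormedModule_isNormedAlgebra (K : numFieldType) A
    & NormedModule K A := {
  bmul : A -> A -> A ;
  bmulA : associative bmul ;
  bmulDl : left_distributive bmul +%R ;
  bmulDr : right_distributive bmul +%R ;
  bmulZl : forall (c : K) x y, bmul (c *: x) y = c *: bmul x y ;
  bmulZr : forall (c : K) x y, bmul x (c *: y) = c *: bmul x y ;
  ler_norm_bmul : forall x y, `|bmul x y| <= `|x| * `|y|
}.

#[short(type="normedAlgType")]
HB.structure Definition NormedAlgebra (K : numFieldType) :=
  {A of NormedModule K A & NormedModule_isNormedAlgebra K A}.

#[short(type="banachAlgType")]
HB.structure Definition BanachAlgebra (K : numFieldType) :=
  {A of NormedAlgebra K A & CompleteNormedModule K A}.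

Notation "x ** y" := (bmul x y) (at level 40, left associativity) : ring_scope.

Definition bounded_linear (K : numFieldType) (E F : normedModType K)
    : {pred E -> F} :=
  [pred f : E -> F |
    `[< linear f /\ exists M : K, forall x, `|f x| <= M * `|x| >] ].
Arguments bounded_linear {K} E F.

Record blin (K : numFieldType) (E F : normedModType K) : predArgType := Blin {
  blin_fun :> E -> F ;
  blin_funP : blin_fun \in bounded_linear E F
}.

Section blin_lmodule.
Context (K : numFieldType) (E F : normedModType K).

HB.instance Definition _ := [isSub for @blin_fun K E F].
HB.instance Definition _ := [Choice of blin E F by <:].

Lemma bounded_linearP (f : E -> F) : f \in bounded_linear E F <->
  linear f /\ exists M : K, forall x, `|f x| <= M * `|x|.
Proof. by split=> [/asboolP//|?]; apply/asboolP. Qed.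

Lemma bounded_linear_submod : submod_closed (bounded_linear E F).
Proof.
split=> [|a f g /bounded_linearP[lf [M hM]] /bounded_linearP[lg [N hN]]].
  apply/bounded_linearP; split=> [a x y|]; first by rewrite scaler0 addr0.
  by exists 0 => x; rewrite normr0 mul0r.
have fgE x : (a *: f + g) x = a *: f x + g x by [].
apply/bounded_linearP; split.
  move=> b x y; rewrite !fgE lf lg.
  by rewrite !scalerDr !scalerA (mulrC a b) addrACA.
exists (`|a| * M + N) => x; rewrite fgE.
rewrite (le_trans (ler_normD _ _))// mulrDl lerD// normrZ -mulrA.
by rewrite ler_wpM2l.
Qed.

HB.instance Definition _ :=
  GRing.isSubmodClosed.Build K (E -> F) (bounded_linear E F)
    bounded_linear_submod.
HB.instance Definition _ := [SubChoice_isSubLmodule of blin E F by <:].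

Lemma blin_linear (f : blin E F) : linear f.
Proof. by have /bounded_linearP[] := blin_funP f. Qed.

HB.instance Definition _ (f : blin E F) :=
  GRing.isLinear.Build K E F *:%R (blin_fun f) (blin_linear f).

Lemma blin_bounded (f : blin E F) :
  exists M : K, 0 <= M /\ forall x, `|f x| <= M * `|x|.
Proof.
have /bounded_linearP[_ [M hM]] := blin_funP f.
have [[x x0]|E0] := pselect (exists x : E, x != 0).
  exists M; split=> //; have := le_trans (normr_ge0 _) (hM x).
  by rewrite pmulr_lge0// normr_gt0.
exists 0; split=> // x; have [->|x0] := eqVneq x 0.
  by rewrite linear0 !normr0 mulr0.
by exfalso; apply: E0; exists x.
Qed.

Lemma blinP (f g : blin E F) : (forall x, f x = g x) -> f = g.
Proof. by move=> fg; apply/val_inj/funext. Qed.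

Definition mk_blin (f : E -> F) (M : K)
    (fM : linear f /\ forall x, `|f x| <= M * `|x|) : blin E F :=
  Blin ((bounded_linearP f).2 (conj fM.1 (ex_intro _ M fM.2))).

End blin_lmodule.

Arguments mk_blin {K E F} f {M}.

Section operator_norm.
Context (R : realType) (k : scalar_kind).
Local Notation K := (scalars R k).
Context (E F : normedModType K).

(* [supremum] rather than [sup]: norms are valued in [K], and [sup] is specific
   to realType *)
Definition opnorm (f : blin E F) : K :=
  supremum 0 [set `|f x| | x in [set x | `|x| <= 1]].

Lemma opnorm_supremums (f : blin E F) :
  supremums [set `|f x| | x in [set x | `|x| <= 1]] (opnorm f).
Proof.
rewrite /opnorm /supremum; case: ifPn => [/eqP A0|A0].
  have : [set `|f x| | x in [set x | `|x| <= 1]] `|f 0|.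
    by exists 0 => //=; rewrite normr0.
  by rewrite A0.
have [M [M0 fM]] := blin_bounded f.
have : supremums [set `|f x| | x in [set x | `|x| <= 1]] !=set0.
  apply: scalars_supremums; first exact/set0P.
  exists M => _ [x /= x1 <-]; rewrite (le_trans (fM x))//.
  by rewrite ler_piMr.
exact: xgetPex.
Qed.

Lemma opnorm_ge0 (f : blin E F) : 0 <= opnorm f.
Proof.
have [ub _] := opnorm_supremums f.
by apply: (le_trans (normr_ge0 (f 0))); apply: ub; exists 0 => //=; rewrite normr0.
Qed.

Lemma ler_opnorm (f : blin E F) x : `|f x| <= opnorm f * `|x|.
Proof.
have [->|x0] := eqVneq x 0; first by rewrite linear0 !normr0 mulr0.
have nx : 0 < `|x| by rewrite normr_gt0.
have [ub _] := opnorm_supremums f.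
have : `|f (`|x|^-1 *: x)| <= opnorm f.
  apply: ub; exists (`|x|^-1 *: x) => //=.
  by rewrite normrZ normfV normr_id mulVf// gt_eqF.
by rewrite linearZ/= normrZ normfV normr_id mulrC ler_pdivrMr.
Qed.

Lemma opnorm_le (f : blin E F) (M : K) :
  0 <= M -> (forall x, `|f x| <= M * `|x|) -> opnorm f <= M.
Proof.
move=> M0 fM; have [_ lub] := opnorm_supremums f.
apply: lub => _ [x /= x1 <-]; rewrite (le_trans (fM x))//.
by rewrite ler_piMr.
Qed.

Let opnormD (f g : blin E F) : opnorm (f + g) <= opnorm f + opnorm g.
Proof.
apply: opnorm_le => [|x]; first by rewrite addr_ge0// opnorm_ge0.
by rewrite mulrDl (le_trans (ler_normD _ _))// lerD// ler_opnorm.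
Qed.

Let opnormZ (c : K) (f : blin E F) : opnorm (c *: f) = `|c| * opnorm f.
Proof.
have le (d : K) (g : blin E F) : opnorm (d *: g) <= `|d| * opnorm g.
  apply: opnorm_le => [|x]; first by rewrite mulr_ge0// opnorm_ge0.
  by rewrite [leLHS]normrZ -mulrA ler_wpM2l// ler_opnorm.
apply/eqP; rewrite eq_le le/=.
have [->|c0] := eqVneq c 0; first by rewrite normr0 mul0r opnorm_ge0.
rewrite mulrC -ler_pdivlMr ?normr_gt0// mulrC -normfV.
by rewrite -{1}(scalerK c0 f) le.
Qed.

Let opnorm0_eq0 (f : blin E F) : opnorm f = 0 -> f = 0.
Proof.
move=> f0; apply: blinP => x; apply/eqP; rewrite -normr_le0.
by have := ler_opnorm f x; rewrite f0 mul0r.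
Qed.

HB.instance Definition _ :=
  Lmodule_isNormed.Build K (blin E F) opnormD opnormZ opnorm0_eq0.

Lemma normr_blinE (f : blin E F) : `|f| = opnorm f.
Proof. by []. Qed.

Lemma ler_norm_blin (f : blin E F) x : `|f x| <= `|f| * `|x|.
Proof. exact: ler_opnorm. Qed.

Lemma normr_blin_le (f : blin E F) (M : K) :
  0 <= M -> (forall x, `|f x| <= M * `|x|) -> `|f| <= M.
Proof. exact: opnorm_le. Qed.

End operator_norm.

Definition dual (R : realType) (k : scalar_kind)
    (E : normedModType (scalars R k)) : Type :=
  blin E (scalars R k : normedModType (scalars R k)).

HB.instance Definition _ (R : realType) (k : scalar_kind)
    (E : normedModType (scalars R k)) := NormedModule.on (dual E).

Section duality.
Context (R : realType) (k : scalar_kind).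
Local Notation K := (scalars R k).
Implicit Types E F : normedModType K.

Lemma ev_subproof E (x : E) :
  linear (fun f : dual E => f x) /\
  forall f : dual E, `|f x| <= `|x| * `|f|.
Proof. by split=> // f; rewrite mulrC ler_norm_blin. Qed.

(* the canonical embedding of a space into its second dual *)
Definition ev E (x : E) : dual (dual E) :=
  mk_blin (fun f : dual E => f x) (ev_subproof x).

Definition reflexive_space E := forall x : dual (dual E), exists y, ev y = x.

Lemma adjoint_subproof E F (T : blin E F) (f : dual F) :
  linear (fun x => f (T x)) /\
  forall x, `|f (T x)| <= (`|f| * `|T|) * `|x|.
Proof.
split=> [a x y|x]; first by rewrite !linearP.
by rewrite (le_trans (ler_norm_blin _ _))// -mulrA ler_wpM2l// ler_norm_blin.
Qed.

Definition adjoint_fun E F (T : blin E F) (f : dual F) : dual E :=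
  mk_blin (fun x => f (T x)) (adjoint_subproof T f).

Lemma adjoint_fun_subproof E F (T : blin E F) :
  linear (adjoint_fun T) /\
  forall f, `|adjoint_fun T f| <= `|T| * `|f|.
Proof.
split=> [a f g|f]; first exact: blinP.
rewrite mulrC; apply: normr_blin_le; first by rewrite mulr_ge0.
exact: (adjoint_subproof T f).2.
Qed.

Definition adjoint E F (T : blin E F) : blin (dual F) (dual E) :=
  mk_blin (adjoint_fun T) (adjoint_fun_subproof T).

(* The topology sigma(E, E') on [E]. *)
Definition weak E := initial_topology
  (fun x : E => (fun f : dual E => f x) : {ptws dual E -> K}).

(* The topology sigma(E', E) on the dual of [E]. *)
Definition weakstar E := initial_topology
  (fun f : dual E => (fun x : E => f x) : {ptws E -> K}).

HB.instance Definition _ E := Topological.on (weak E).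
HB.instance Definition _ E := Topological.on (weakstar E).

End duality.

Record directedType := Directed {
  directed_sort :> Type ;
  dir_le : directed_sort -> directed_sort -> Prop ;
  dir_inhabited : inhabited directed_sort ;
  dir_refl : forall i, dir_le i i ;
  dir_trans : forall i j l, dir_le i j -> dir_le j l -> dir_le i l ;
  dir_ub : forall i j, exists l, dir_le i l /\ dir_le j l
}.

(* The filter of the sets in which a net indexed by [I] eventually is: a net
   [a : I -> T] converges to [l] when [a @ tails I --> l]. *)
Definition tails (I : directedType) : set_system I :=
  filter_from setT (fun i => [set j | dir_le i j]).
Arguments tails : clear implicits.

#[global] Instance tails_filter (I : directedType) : ProperFilter (tails I).
Proof.
apply: filter_from_proper => [|i _]; last by exists i; exact: dir_refl.
apply: filter_from_filter => [|i j _ _].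
  by case: (dir_inhabited I) => i; exists i.
have [l [il jl]] := dir_ub i j; exists l => // m lm.
by split; apply: dir_trans lm.
Qed.

(* Module actions are written in the order of the arguments: for [a] in [A],
   [f] in the dual and [x] in the second dual of [A], [dactr f a] is f.a,
   [dactl a f] is a.f, [biactl x f] is x.f and [biactr f x] is f.x, where the
   last one is used for the second Arens product only. *)
Section module_actions.
Context (R : realType) (k : scalar_kind).
Local Notation K := (scalars R k).
Context (A : normedAlgType K).

Lemma dactr_subproof (f : dual A) (a : A) :
  linear (fun b => f (a ** b)) /\
  forall b, `|f (a ** b)| <= (`|f| * `|a|) * `|b|.
Proof.
split=> [c x y|b]; first by rewrite bmulDr bmulZr linearP.
rewrite (le_trans (ler_norm_blin _ _))// -mulrA ler_wpM2l//.
exact: ler_norm_bmul.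
Qed.

Definition dactr (f : dual A) (a : A) : dual A :=
  mk_blin (fun b => f (a ** b)) (dactr_subproof f a).

Lemma dactl_subproof (a : A) (f : dual A) :
  linear (fun b => f (b ** a)) /\
  forall b, `|f (b ** a)| <= (`|f| * `|a|) * `|b|.
Proof.
split=> [c x y|b]; first by rewrite bmulDl bmulZl linearP.
rewrite (le_trans (ler_norm_blin _ _))// -mulrA ler_wpM2l//.
by rewrite mulrC ler_norm_bmul.
Qed.

Definition dactl (a : A) (f : dual A) : dual A :=
  mk_blin (fun b => f (b ** a)) (dactl_subproof a f).

Lemma normr_dactr f a : `|dactr f a| <= `|f| * `|a|.
Proof.
by apply: normr_blin_le; rewrite ?mulr_ge0//; exact: (dactr_subproof f a).2.
Qed.

Lemma normr_dactl a f : `|dactl a f| <= `|f| * `|a|.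
Proof.
by apply: normr_blin_le; rewrite ?mulr_ge0//; exact: (dactl_subproof a f).2.
Qed.

Lemma biactl_subproof (x : dual (dual A)) (f : dual A) :
  linear (fun a => x (dactr f a)) /\
  forall a, `|x (dactr f a)| <= (`|x| * `|f|) * `|a|.
Proof.
split=> [c a b|a].
  rewrite -linearP; congr (x _); apply: blinP => d /=.
  by rewrite bmulDl bmulZl linearP.
rewrite (le_trans (ler_norm_blin _ _))// -mulrA ler_wpM2l//.
exact: normr_dactr.
Qed.

Definition biactl (x : dual (dual A)) (f : dual A) : dual A :=
  mk_blin (fun a => x (dactr f a)) (biactl_subproof x f).

Lemma biactr_subproof (f : dual A) (x : dual (dual A)) :
  linear (fun a => x (dactl a f)) /\
  forall a, `|x (dactl a f)| <= (`|x| * `|f|) * `|a|.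
Proof.
split=> [c a b|a].
  rewrite -linearP; congr (x _); apply: blinP => d /=.
  by rewrite bmulDr bmulZr linearP.
rewrite (le_trans (ler_norm_blin _ _))// -mulrA ler_wpM2l//.
exact: normr_dactl.
Qed.

Definition biactr (f : dual A) (x : dual (dual A)) : dual A :=
  mk_blin (fun a => x (dactl a f)) (biactr_subproof f x).

Lemma normr_biactl x f : `|biactl x f| <= `|x| * `|f|.
Proof.
by apply: normr_blin_le; rewrite ?mulr_ge0//; exact: (biactl_subproof x f).2.
Qed.

Lemma normr_biactr f x : `|biactr f x| <= `|x| * `|f|.
Proof.
by apply: normr_blin_le; rewrite ?mulr_ge0//; exact: (biactr_subproof f x).2.
Qed.

Lemma arens1_subproof (x y : dual (dual A)) :
  linear (fun f => x (biactl y f)) /\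
  forall f, `|x (biactl y f)| <= (`|x| * `|y|) * `|f|.
Proof.
split=> [c f g|f].
  rewrite -linearP; congr (x _); apply: blinP => d /=.
  rewrite -[RHS]/(c *: y (dactr f d) + y (dactr g d)) -linearP.
  by congr (y _); exact: blinP.
rewrite (le_trans (ler_norm_blin _ _))// -mulrA ler_wpM2l//.
exact: normr_biactl.
Qed.

(* the first Arens product *)
Definition arens1 (x y : dual (dual A)) : dual (dual A) :=
  mk_blin (fun f => x (biactl y f)) (arens1_subproof x y).

Lemma arens2_subproof (x y : dual (dual A)) :
  linear (fun f => y (biactr f x)) /\
  forall f, `|y (biactr f x)| <= (`|x| * `|y|) * `|f|.
Proof.
split=> [c f g|f].
  rewrite -linearP; congr (y _); apply: blinP => d /=.
  rewrite -[RHS]/(c *: x (dactl d f) + x (dactl d g)) -linearP.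
  by congr (x _); exact: blinP.
rewrite (le_trans (ler_norm_blin _ _))// (mulrC `|x|) -mulrA ler_wpM2l//.
exact: normr_biactr.
Qed.

(* the second Arens product *)
Definition arens2 (x y : dual (dual A)) : dual (dual A) :=
  mk_blin (fun f => y (biactr f x)) (arens2_subproof x y).

Definition arens_regular := forall x y, arens1 x y = arens2 x y.

Lemma arens1A : associative arens1.
Proof.
move=> x y z; apply: blinP => f /=; congr (x _); apply: blinP => a /=.
congr (y _); apply: blinP => b /=; congr (z _); apply: blinP => c /=.
by rewrite bmulA.
Qed.

Lemma arens1Dl : left_distributive arens1 +%R.
Proof. by move=> x y z; exact: blinP. Qed.

Lemma arens1Dr : right_distributive arens1 +%R.
Proof.
move=> x y z; apply: blinP => f /=.
rewrite -[RHS]/(x (biactl y f) + x (biactl z f)) -linearD.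
by congr (x _); exact: blinP.
Qed.

Lemma arens1Zl (c : K) x y : arens1 (c *: x) y = c *: arens1 x y.
Proof. exact: blinP. Qed.

Lemma arens1Zr (c : K) x y : arens1 x (c *: y) = c *: arens1 x y.
Proof.
apply: blinP => f /=.
rewrite -[RHS]/(c *: x (biactl y f)) -linearZ.
by congr (x _); exact: blinP.
Qed.

Lemma normr_arens1 x y : `|arens1 x y| <= `|x| * `|y|.
Proof.
by apply: normr_blin_le; rewrite ?mulr_ge0//; exact: (arens1_subproof x y).2.
Qed.

(* The second dual is an algebra for the first Arens product, hence [dactl] and
   [dactr] also define the actions of the second dual on the third one. *)
HB.instance Definition _ := NormedModule_isNormedAlgebra.Build K
  (dual (dual A)) arens1A arens1Dl arens1Dr arens1Zl arens1Zr normr_arens1.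

(* Derivations into the dual bimodule; boundedness and linearity are part of the
   type of [D]. *)
Definition derivation (D : blin A (dual A)) :=
  forall a b, D (a ** b) = dactl a (D b) + dactr (D a) b.

Definition left_bai := exists (I : directedType) (e : I -> A),
  (exists M : K, forall i, `|e i| <= M) /\
  forall a, (e i ** a) @[i --> tails I] --> a.

End module_actions.

Arguments left_bai {R k} A.
Arguments arens_regular {R k} A.

Section wstarwc.
Context (R : realType) (k : scalar_kind).
Local Notation K := (scalars R k).
Context (A : normedAlgType K).

(* [dactr (ev f) x] is the element [f x] of the third dual, for the module
   structure over the second dual of [A] with the first Arens product. *)
Definition dual_Lwstarwc := forall (f : dual A) (x : dual (dual A)),
  exists fx : dual A, ev fx = dactr (ev f) x /\
  forall (I : directedType) (a : I -> A),
    ev (a i) @[i --> tails I] --> (x : weakstar (dual A)) ->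
    dactr f (a i) @[i --> tails I] --> (fx : weak (dual A)).

Definition dual_Rwstarwc := forall (f : dual A) (x : dual (dual A))
    (I : directedType) (a : I -> A),
  ev (a i) @[i --> tails I] --> (x : weakstar (dual A)) ->
  dactl (a i) f @[i --> tails I] --> (biactl x f : weak (dual A)).

Definition dual_wstarwc := dual_Lwstarwc /\ dual_Rwstarwc.

Definition bidual_Lwstarwc := forall (y x : dual (dual A))
    (I : directedType) (a : I -> A),
  ev (a i) @[i --> tails I] --> (x : weakstar (dual A)) ->
  y ** ev (a i) @[i --> tails I] --> (y ** x : weak (dual (dual A))).

End wstarwc.

Arguments dual_wstarwc {R k} A.
Arguments bidual_Lwstarwc {R k} A.

(* Main.v *)
(* Write x.y for the first Arens product and A', A'', A''' for the iterated duals.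
   At z, the derivation identity for D'' reads y(D'(z.x)) = (x.y)(D'z) - x(D'(y.z)),
   whose right-hand side is the value of x at an element of A'.  As D is onto, D'
   is bounded below (uniform boundedness on the Banach space A'), so D'' is onto
   A''' (Hahn-Banach).  Hence for every phi in A''' and z in A'' the functional
   x |-> phi(z.x) is the evaluation at an element g of A', which gives (2) and the
   property of A'' in (1).  For phi in A', testing on x in A shows that g is the
   action of the second Arens product: A is Arens regular, and the property of A'
   in (1) follows.  If A has a left bounded approximate identity, then some e in
   A'' satisfies e.x = x for all x, so every phi in A''' is an evaluation: A' is
   reflexive, hence so is A. *)

Require Import Defs.
From HB Require Import structures.
From mathcomp Require Import all_boot all_order all_algebra.
From mathcomp Require Import complex.
From mathcomp Require Import all_classical all_reals all_analysis.
From mathcomp Require Import ring lra.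

Set Implicit Arguments.
Unset Strict Implicit.
Unset Printing Implicit Defensive.

Import Order.TTheory GRing.Theory Num.Theory.
Import numFieldNormedType.Exports.

Local Open Scope classical_set_scope.
Local Open Scope ring_scope.

(** * Real parts of scalars, and the copy of the reals inside [K] *)

Section real_part.
Context (R : realType) (k : scalar_kind).
Local Notation K := (scalars R k).

Definition re : K -> R :=
  match k return scalars R k -> R with
  | RealScalars => id
  | ComplexScalars => @complex.Re R
  end.

Definition of_real : R -> K :=
  match k return R -> scalars R k with
  | RealScalars => id
  | ComplexScalars => real_complex R
  end.

Lemma of_real_zmod_morphism : zmod_morphism of_real.
Proof. by rewrite /of_real; case: k => // x y; rewrite rmorphB. Qed.

Lemma of_real_monoid_morphism : monoid_morphism of_real.
Proof.
rewrite /of_real; case: k => //; split; first exact: rmorph1.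
by move=> x y; rewrite rmorphM.
Qed.

HB.instance Definition _ :=
  GRing.isZmodMorphism.Build R K of_real of_real_zmod_morphism.
HB.instance Definition _ :=
  GRing.isMonoidMorphism.Build R K of_real of_real_monoid_morphism.

Lemma re_zmod_morphism : zmod_morphism re.
Proof. by rewrite /re; case: k => // -[a b] [c d]. Qed.

HB.instance Definition _ :=
  GRing.isZmodMorphism.Build K R re re_zmod_morphism.

Lemma re_of_realM c z : re (of_real c * z) = c * re z.
Proof. by rewrite /re /of_real; case: k z => //= -[a b] /=; rewrite mul0r subr0. Qed.

Lemma of_realK : cancel of_real re.
Proof. by rewrite /re /of_real; case: k. Qed.

Lemma ge0_reK z : 0 <= z -> of_real (re z) = z.
Proof.
rewrite /re /of_real; case: k z => //= -[a b]; rewrite lecE/= => /andP[/eqP b0 _].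
by rewrite b0.
Qed.

Lemma ler_re x y : x <= y -> re x <= re y.
Proof. by rewrite /re; case: k x y => //= x y; rewrite lecE => /andP[]. Qed.

Lemma ler_of_real : {mono of_real : x y / x <= y}.
Proof. by rewrite /of_real; case: k => //= x y; rewrite lecE/= eqxx. Qed.

Lemma ltr_of_real : {mono of_real : x y / x < y}.
Proof. by rewrite /of_real; case: k => //= x y; rewrite ltcE/= eqxx. Qed.

Lemma re_le_norm z : re z <= re `|z|.
Proof.
rewrite /re; case: k z => /= z; first exact: ler_norm.
apply: le_trans (ler_norm _) _.
by have := normc_ge_Re z; rewrite lecE => /andP[].
Qed.

Lemma ler_norm_re z : `|re z| <= re `|z|.
Proof. by rewrite ler_norml lerNl -raddfN -{1}normrN !re_le_norm. Qed.

Lemma normr_of_real c : `|of_real c| = of_real `|c|.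
Proof.
have [c0|c0] := leP 0 c; first by rewrite !ger0_norm// -(rmorph0 of_real) ler_of_real.
by rewrite !ltr0_norm// ?rmorphN// -(rmorph0 of_real) ltr_of_real.
Qed.

(** Otherwise the multiple by [z^-1] has real part 1. *)
Lemma re_eq0 z : (forall c, re (c * z) = 0) -> z = 0.
Proof.
move=> z0; have [//|nz] := eqVneq z 0.
have := z0 z^-1; rewrite mulVf// -(rmorph1 of_real) of_realK => /eqP.
by rewrite oner_eq0.
Qed.

End real_part.

Arguments re {R k}.
Arguments of_real {R k}.

(** * The Hahn-Banach theorem over the reals, with a sublinear bound [p] *)

(* The graph of a linear map is a set [G] of pairs, on which the conditions of
   the Hahn-Banach theorem are closed under unions of chains. *)
Section hahn_banach_real.
Context (R : realType) (V : lmodType R) (p : V -> R).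
Hypothesis pD : forall x y, p (x + y) <= p x + p y.
Hypothesis pZ : forall (c : R) x, 0 < c -> p (c *: x) = c * p x.
Implicit Types G : set (V * R).

Definition linear_graph G :=
  forall (c : R) u v, G u -> G v -> G (c *: u.1 + v.1, c * u.2 + v.2).

Definition dominated_graph G := linear_graph G /\ forall u, G u -> u.2 <= p u.1.

Lemma linear_graph0 G : linear_graph G -> G !=set0 -> G (0, 0).
Proof.
move=> lG [u Gu]; have := lG (-1) u u Gu Gu.
by rewrite scaleN1r addNr mulN1r addNr.
Qed.

Lemma linear_graphZ G c u :
  linear_graph G -> G !=set0 -> G u -> G (c *: u.1, c * u.2).
Proof.
move=> lG G0 Gu; have := lG c u (0, 0) Gu (linear_graph0 lG G0).
by rewrite /= !addr0.
Qed.

(** The difference of two values at [x] is a value at 0, hence at most [p 0], which is 0 by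
    homogeneity. *)
Lemma dominated_graph_fun G x r s :
  dominated_graph G -> G (x, r) -> G (x, s) -> r = s.
Proof.
move=> [lG pG] Gr Gs.
have G0 : G !=set0 by exists (x, r).
have p0 : p 0 = 0.
  by have := @pZ 2 0 (ltr0n R 2); rewrite scaler0; lra.
have le a b : G (x, a) -> G (x, b) -> a <= b.
  move=> Ga Gb; have := pG _ (lG (-1) _ _ Gb Ga).
  by rewrite /= scaleN1r addNr p0 mulN1r; lra.
by apply/eqP; rewrite eq_le !le.
Qed.

(** The value [t] has to separate the lower bounds [u.2 - p (u.1 - x0)] from the upper bounds
    [p (v.1 + x0) - v.2]; subadditivity of [p] leaves room for it. *)
Lemma dominated_graph_extend G x0 : dominated_graph G -> G !=set0 ->
  exists2 H, dominated_graph H & G `<=` H /\ exists t, H (x0, t).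
Proof.
move=> [lG pG] G0.
pose L := [set u.2 - p (u.1 - x0) | u in G].
have leL u v : G u -> G v -> u.2 - p (u.1 - x0) <= p (v.1 + x0) - v.2.
  move=> Gu Gv; have := pG _ (lG 1 _ _ Gu Gv); rewrite /= scale1r mul1r => h.
  have := pD (u.1 - x0) (v.1 + x0); rewrite addrACA addNr addr0; lra.
have L0 : L !=set0 by case: G0 => u Gu; exists (u.2 - p (u.1 - x0)), u.
pose t := sup L.
have hlo u : G u -> u.2 - t <= p (u.1 - x0).
  move=> Gu; rewrite lerBlDr -lerBlDl; apply: ub_le_sup; last by exists u.
  by case: G0 => v Gv; exists (p (v.1 + x0) - v.2) => _ [w Gw <-]; exact: leL.
have hup u : G u -> u.2 + t <= p (u.1 + x0).
  move=> Gu; rewrite -lerBrDl; apply: ge_sup => // _ [w Gw <-]; exact: leL.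
exists [set w | exists u c, G u /\ w = (u.1 + c *: x0, u.2 + c * t)]; split.
- move=> d _ _ [u [c [Gu ->]]] [v [e [Gv ->]]] /=.
  exists (d *: u.1 + v.1, d * u.2 + v.2), (d * c + e); split; first exact: lG.
  congr pair => /=; last by ring.
  by rewrite scalerDr scalerDl scalerA addrACA.
- move=> _ [u [c [Gu ->]]] /=.
  have Gc := linear_graphZ _ lG G0 Gu.
  (* Rescaling by the inverse of [|c|] reduces a negative [c] to [hlo] and a positive one to
     [hup]. *)
  have [c0|c0|->] := ltgtP c 0; last by rewrite scale0r mul0r !addr0; exact: pG.
    have := hlo _ (Gc (- c)^-1); rewrite /=.
    have -> : u.1 + c *: x0 = (- c) *: ((- c)^-1 *: u.1 - x0).
      by rewrite scalerBr scalerA mulfV ?scale1r ?scaleNr ?opprK// oppr_eq0 lt_eqF.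
    rewrite pZ ?oppr_gt0// -(ler_pM2l (x := - c)) ?oppr_gt0//.
    by rewrite mulrBr mulrA mulfV ?mul1r ?mulNr ?opprK// oppr_eq0 lt_eqF.
  have := hup _ (Gc c^-1); rewrite /=.
  have -> : u.1 + c *: x0 = c *: (c^-1 *: u.1 + x0).
    by rewrite scalerDr scalerA mulfV ?scale1r// gt_eqF.
  rewrite pZ// -(ler_pM2l (x := c))//.
  by rewrite mulrDr mulrA mulfV ?mul1r// gt_eqF.
- by move=> u Gu; exists u, 0; split=> //; rewrite scale0r mul0r !addr0; case: u {Gu}.
- exists t, (0, 0), 1; split; first exact: linear_graph0.
  by rewrite /= scale1r mul1r !add0r.
Qed.

Lemma dominated_graph_bigcup (F : set (set (V * R))) :
  F `<=` dominated_graph -> total_on F subset ->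
  dominated_graph (\bigcup_(G in F) G).
Proof.
move=> FP Ftot; split; last by move=> u [G FG Gu]; exact: (FP _ FG).2.
move=> c u v [G FG Gu] [H FH Hv].
have [GH|HG] := Ftot _ _ FG FH.
  by exists H => //; apply: (FP _ FH).1 => //; exact: GH.
by exists G => //; apply: (FP _ FG).1 => //; exact: HG.
Qed.

Theorem hahn_banach_real G : dominated_graph G -> G !=set0 ->
  exists f : V -> R, [/\ linear (f : V -> R^o),
    forall x, f x <= p x & forall u, G u -> f u.1 = u.2].
Proof.
move=> dG [g Gg].
(* Zorn's lemma also asks for the union of the empty chain; joining [G] to each [H] makes it
   admissible. *)
pose P := [set H : set (V * R) | dominated_graph (G `|` H)].
have [F FP Ftot|H [PH Hmax]] := @Zorn_bigcup _ P.
  have [->|F0] := eqVneq F set0.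
    by rewrite bigcup_set0 /P /= setU0.
  rewrite /P /= (_ : _ `|` _ = \bigcup_(H in [set G `|` H | H in F]) H).
    apply: dominated_graph_bigcup; first by move=> _ [H FH <-]; exact: FP.
    move=> _ _ [H FH <-] [I FI <-].
    by have [HI|IH] := Ftot _ _ FH FI; [left|right]; exact: setUS.
  rewrite bigcup_image; move/set0P: F0 => [H0 FH0].
  apply/seteqP; split=> [u [Gu|[H FH Hu]]|u [H FH [Gu|Hu]]].
  - by exists H0 => //; left.
  - by exists H => //; right.
  - by left.
  - by right; exists H.
have [lM pM] := PH; set M := G `|` H in PH lM pM.
have M0 : M !=set0 by exists g; left.
(* By maximality the domain is everything: an extension [N] reaching a new [x] would strictly
   contain [H]. *)
have dom x : exists t, M (x, t).
  have [N dN [MN [t Nt]]] := dominated_graph_extend x PH M0.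
  exists t; apply: contrapT => nMt; apply: (Hmax N).
    split=> [u Hu|NH]; first by apply: MN; right.
    by apply: nMt; right; exact: NH.
  by rewrite /P /= (_ : _ `|` _ = N)//; apply/setUidPr => u Gu; apply: MN; left.
have [f Mf] := choice dom.
exists f; split=> [c x y|x|[x r] Gu] /=.
- apply: dominated_graph_fun PH (Mf _) _; exact: (lM c _ _ (Mf x) (Mf y)).
- exact: (pM _ (Mf x)).
- by apply: dominated_graph_fun PH (Mf x) _; left.
Qed.

End hahn_banach_real.

(** * Restriction of scalars to the reals, on an alias that leaves the structure over [K] in
    place *)

Definition realify (R : realType) (k : scalar_kind)
    (E : normedModType (scalars R k)) : Type := E.

Section realify.
Context (R : realType) (k : scalar_kind).
Local Notation K := (scalars R k).
Context (E : normedModType K).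

HB.instance Definition _ := GRing.Zmodule.copy (realify E) E.

Definition realify_scale (c : R) (x : realify E) : realify E :=
  (of_real c : K) *: (x : E).

Fact realify_scalerA c d x :
  realify_scale c (realify_scale d x) = realify_scale (c * d) x.
Proof. by rewrite /realify_scale scalerA rmorphM. Qed.

Fact realify_scale1r : left_id 1 realify_scale.
Proof. by move=> x; rewrite /realify_scale rmorph1 scale1r. Qed.

Fact realify_scalerDr : right_distributive realify_scale +%R.
Proof. by move=> c x y; rewrite /realify_scale scalerDr. Qed.

Fact realify_scalerDl x : {morph realify_scale^~ x : c d / c + d}.
Proof. by move=> c d; rewrite /realify_scale rmorphD scalerDl. Qed.

HB.instance Definition _ := GRing.Zmodule_isLmodule.Build R (realify E)
  realify_scalerA realify_scale1r realify_scalerDr realify_scalerDl.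

Definition realify_norm (x : realify E) : R := re `|x : E|.

Fact realify_normD x y : realify_norm (x + y) <= realify_norm x + realify_norm y.
Proof. by rewrite /realify_norm -raddfD ler_re// ler_normD. Qed.

Fact realify_normZ (c : R) x : realify_norm (c *: x) = `|c| * realify_norm x.
Proof. by rewrite /realify_norm normrZ normr_of_real re_of_realM. Qed.

Fact realify_norm0_eq0 x : realify_norm x = 0 -> x = 0.
Proof.
rewrite /realify_norm => x0; apply/eqP; rewrite -(normr_eq0 (x : E)).
by rewrite -[X in X == 0]ge0_reK// x0 raddf0.
Qed.

HB.instance Definition _ := Lmodule_isNormed.Build R (realify E)
  realify_normD realify_normZ realify_norm0_eq0.

Lemma realify_normE (x : realify E) : `|x| = re `|x : E|.
Proof. by []. Qed.

Lemma of_real_realify_norm (x : E) : of_real `|x : realify E| = `|x|.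
Proof. exact: ge0_reK. Qed.

Lemma realify_scaleE (c : R) (x : realify E) : c *: x = (of_real c : K) *: (x : E).
Proof. by []. Qed.

End realify.

(** * Hahn-Banach, completeness of duals and uniform boundedness over [K] *)

Section real_functionals.
Context (R : realType) (k : scalar_kind).
Local Notation K := (scalars R k).
Implicit Types E : normedModType K.

(* Multiplying [x] by a scalar of norm [1] makes [f x] real and nonnegative. *)
Lemma le_norm_re E (f : E -> K) (M : R) : scalable_for *%R f ->
  (forall x, re (f x) <= M * `|x : realify E|) ->
  forall x, `|f x| <= of_real M * `|x|.
Proof.
move=> fZ fM x; rewrite -(of_real_realify_norm x) -rmorphM.
have [fx0|fx0] := eqVneq (f x) 0.
  rewrite fx0 normr0 -(rmorph0 of_real) ler_of_real.
  by apply: le_trans (fM x); rewrite fx0 raddf0.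
have c1 : `|(`|f x| / f x)| = 1 by rewrite normf_div normr_id divff// normr_eq0.
rewrite -[leLHS]ge0_reK// ler_of_real.
have := fM ((`|f x| / f x) *: x).
by rewrite fZ divfK// [X in _ <= _ * X]realify_normE normrZ c1 mul1r.
Qed.

(** In the complex case [f] is the classical x |-> u(x) - i u(ix). *)
Lemma complexify E (u : realify E -> R) : linear (u : realify E -> R^o) ->
  exists f : E -> K, linear f /\ forall x, re (f x) = u x.
Proof.
case: k E u => E u lu; first by exists u.
have uD x y : u (x + y) = u x + u y by have := lu 1 x y; rewrite !scale1r.
have u0 : u 0 = 0 by have := uD 0 0; rewrite addr0; lra.
have uZ (c : R) (x : E) : u ((c%:C)%C *: x) = c * u x.
  by have := lu c x 0; rewrite u0 !addr0.
have uiD (x y : E) : u ('i%C *: (x + y)) = u ('i%C *: x) + u ('i%C *: y).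
  by rewrite scalerDr uD.
have uC (c : R[i]) (x : E) :
    u (c *: x) = complex.Re c * u x + complex.Im c * u ('i%C *: x).
  have -> : c *: x = ((complex.Re c)%:C)%C *: x +
      ((complex.Im c)%:C)%C *: ('i%C *: x).
    by rewrite scalerA -scalerDl {1}[c]complexE [X in _ + X]mulrC.
  by rewrite -!uZ; exact: uD.
exists (fun x => Complex (u x) (- u ('i%C *: x))); split=> [c x y|x]; last first.
  exact: erefl.
have h1 := uC c x; have h2 := uC ('i%C * c) x; rewrite -scalerA in h2.
rewrite uiD uD h1 h2.
case: c {h1 h2} => a b; apply/eqP; rewrite eq_complex /=.
by apply/andP; split; apply/eqP; ring.
Qed.

Lemma real_functional_ext E (u : realify E -> R) (M : R) : 0 <= M ->
  linear (u : realify E -> R^o) -> (forall x, u x <= M * `|x|) ->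
  exists f : dual E, (forall x, re (f x) = u x) /\ `|f| <= of_real M.
Proof.
move=> M0 /complexify[f [lf fu]] uM.
have f0 : f 0 = 0 by have := lf (-1) 0 0; rewrite scaler0 addr0 scaleN1r addNr.
have fM x : `|f x| <= of_real M * `|x|.
  apply: le_norm_re => [c y|y]; last by rewrite fu.
  by have := lf c y 0; rewrite f0 !addr0.
exists (mk_blin f (conj lf fM)); split=> //.
by apply: normr_blin_le => //; rewrite -(rmorph0 of_real) ler_of_real.
Qed.

(* [G] is the graph of a linear functional defined on a subspace of [E]. *)
Theorem hahn_banach E (G : set (E * K)) (M : K) : 0 <= M -> G !=set0 ->
  (forall c u v, G u -> G v -> G (c *: u.1 + v.1, c * u.2 + v.2)) ->
  (forall u, G u -> `|u.2| <= M * `|u.1|) ->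
  exists f : dual E, (forall u, G u -> f u.1 = u.2) /\ `|f| <= M.
Proof.
move=> M0 [g Gg] lG GM; rewrite -(ge0_reK M0).
have m0 : 0 <= re M by have := ler_re M0; rewrite raddf0.
pose p (x : realify E) := re M * `|x|.
pose H := [set (u.1 : realify E, re u.2) | u in G].
have [||||u [lu up Hu]] := @hahn_banach_real R (realify E) p _ _ H.
- by move=> x y; rewrite /p -mulrDr ler_wpM2l// ler_normD.
- by move=> c x c0; rewrite /p normrZ gtr0_norm// mulrCA.
- split=> [c _ _ [u Gu <-] [v Gv <-]|_ [u Gu <-]] /=.
    exists (of_real c *: u.1 + v.1, of_real c * u.2 + v.2); first exact: lG.
    by rewrite /= raddfD/= re_of_realM.
  rewrite /p -(ler_of_real k) [leRHS]rmorphM/= (ge0_reK M0).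
  have -> := of_real_realify_norm u.1.
  apply: le_trans _ (GM _ Gu).
  by rewrite -[leRHS]ge0_reK// ler_of_real re_le_norm.
- by exists (g.1 : realify E, re g.2), g.
have [f [fu fM]] := real_functional_ext m0 lu up.
(* [G] is stable under scalars of [K], so the real parts agree at every multiple of [v]; [re_eq0]
   then recovers the values. *)
exists f; split=> // v Gv; apply/eqP; rewrite -subr_eq0; apply/eqP/re_eq0 => c.
have G0 : G (0, 0).
  by have := lG (-1) _ _ Gv Gv; rewrite scaleN1r addNr mulN1r addNr.
have := lG c _ _ Gv G0; rewrite !addr0 => Gcv.
have fZ : f (c *: v.1) = c * f v.1 by rewrite linearZ.
rewrite mulrBr -fZ raddfB/= fu.
by rewrite (Hu (_, re (c * v.2))) ?subrr//; exists (c *: v.1, c * v.2).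
Qed.

Lemma norm_dual_le E (f : dual E) (M : R) : 0 <= M ->
  (forall x, re (f x) <= M * `|x : realify E|) -> `|f : realify (dual E)| <= M.
Proof.
move=> M0 fM; rewrite realify_normE -[leRHS](of_realK k); apply: ler_re.
apply: normr_blin_le; first by rewrite -(rmorph0 of_real) ler_of_real.
by apply: le_norm_re => // c x; rewrite linearZ.
Qed.

Lemma norm_re_dual E (f : dual E) (x : E) :
  `|re (f x)| <= `|f : realify (dual E)| * `|x : realify E|.
Proof.
apply: le_trans (ler_norm_re _) _.
rewrite -(of_realK k (_ * _)) rmorphM/= !of_real_realify_norm.
exact/ler_re/ler_norm_blin.
Qed.

(** The limit is built from the pointwise limits of the real parts, then recovered over [K].
    Completeness makes Banach-Steinhaus available on the dual. *)
Lemma real_dual_complete E (F : set_system (realify (dual E))) :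
  ProperFilter F -> cauchy F -> cvg F.
Proof.
move=> FF /cauchy_ballP Fc.
have Fball e : 0 < e -> exists g : realify (dual E),
    \forall f \near F, `|f - g| <= e.
  move=> e0; have [[A B] [/= FA FB] AB] := Fc _ e0.
  have [g Bg] := filter_ex FB; exists g; apply: filterS FA => f Af.
  by have := AB (f, g) (conj Af Bg); rewrite -ball_normE/= => /ltW.
have ev_le (f g : realify (dual E)) e : `|f - g| <= e ->
    forall x : E, `|re ((f : dual E) x) - re ((g : dual E) x)| <= e * `|x : realify E|.
  move=> fge x; rewrite -raddfB/=.
  by apply: le_trans (norm_re_dual (f - g) x) _; rewrite ler_wpM2r.
have cvg_re (x : E) : cvg (re ((f : dual E) x) @[f --> F]).
  apply: cauchy_cvg; apply: cauchy_exP => e e0.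
  have x1 : 0 < `|x : realify E| + 1 by rewrite ltr_wpDl.
  have [g Fg] := Fball _ (divr_gt0 e0 x1).
  exists (re ((g : dual E) x)); apply: filterS Fg => f /ev_le/(_ x) fg.
  rewrite /preimage/= -ball_normE/= distrC.
  apply: le_lt_trans fg _; rewrite mulrAC ltr_pdivrMr// ltr_pM2l//.
  by rewrite ltrDl.
pose u (x : realify E) : R := lim (re ((f : dual E) x) @[f --> F]).
have lu : linear (u : realify E -> R^o).
  move=> c x y; apply: cvg_lim => //.
  have -> : (fun f : realify (dual E) => re ((f : dual E) (c *: x + y))) =
      (fun f => c * re ((f : dual E) x) + re ((f : dual E) y)).
    by apply/funext => f; rewrite realify_scaleE linearP raddfD/= re_of_realM.
  apply: cvgD; last exact: cvg_re.
  by apply: cvgM; [exact: cvg_cst|exact: cvg_re].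
(* Balls pass to the pointwise limit; this serves first to bound [u], then to prove convergence in
   norm. *)
have ug e g : (\forall f \near F, `|f - g| <= e) ->
    forall x : E, `|u x - re ((g : dual E) x)| <= e * `|x : realify E|.
  move=> Fg x; rewrite ler_distl; apply/andP; split.
    apply: limr_ge; first exact: cvg_re.
    by apply: filterS Fg => f /ev_le/(_ x); rewrite ler_distl => /andP[].
  apply: limr_le; first exact: cvg_re.
  by apply: filterS Fg => f /ev_le/(_ x); rewrite ler_distl => /andP[].
have [g1 /ug g1u] := Fball 1 ltr01.
have [|//|x|l [lu_ _]] := @real_functional_ext _ u (`|g1| + 1).
- by rewrite addr_ge0.
- have := g1u x; rewrite ler_distl => /andP[_]; move/le_trans; apply.
  by rewrite mulrDl lerD2r (le_trans (ler_norm _))// norm_re_dual.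
apply/cvg_ex; exists (l : realify (dual E)); apply/fcvg_ballP => e e0.
have e3 : 0 < e / 3 by rewrite divr_gt0.
have [g Fg] := Fball _ e3.
have lg : `|(l : realify (dual E)) - g| <= e / 3.
  apply: norm_dual_le; first exact: ltW.
  move=> x; apply: le_trans (ler_norm _) _.
  by have := ug _ _ Fg x; rewrite -lu_ -raddfB.
apply: filterS Fg => f fg; rewrite -ball_normE/=.
apply: le_lt_trans (ler_distD g _ _) _; rewrite (distrC g).
by apply: le_lt_trans (lerD lg fg) _; lra.
Qed.

HB.instance Definition _ E := Uniform_isComplete.Build (realify (dual E))
  (@real_dual_complete E).

(** Banach-Steinhaus on the real Banach space underlying [dual E], applied to the real parts of the
    members of [W]. *)
Theorem uniform_boundedness E (W : set (dual (dual E))) :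
  (forall f, exists M : R, forall w, W w -> `|w f| <= of_real M) ->
  exists M : R, 0 <= M /\ forall w, W w -> `|w| <= of_real M.
Proof.
move=> Wbd.
pose V : completeNormedModType R := realify (dual E).
pose ree (w : dual (dual E)) : V -> R^o := fun f => re (w f).
have [_ [w Ww <-]||M WM] := @Banach_Steinhauss R V R^o (ree @` W) _ _ 1.
- split=> [r|c f g].
    exists (`|w : realify (dual (dual E))| * r) => f fr.
    by apply: le_trans (norm_re_dual w f) _; rewrite ler_wpM2l.
  by rewrite /ree realify_scaleE linearP raddfD/= re_of_realM.
- move=> f; have [M WM] := Wbd f; exists M => _ [w Ww <-].
  apply: le_trans (ler_norm_re _) _; rewrite -[leRHS](of_realK k).
  by apply: ler_re; exact: WM.
exists `|M|; split=> // w Ww.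
rewrite -[leLHS](of_real_realify_norm (E := dual (dual E))) ler_of_real.
apply: norm_dual_le => // f; apply: le_trans (ler_norm _) _.
have [f0|f0] := eqVneq `|f : V| 0.
  have /eqP -> : f == 0 by rewrite -(normr_eq0 (f : V)) f0.
  by rewrite linear0 raddf0 normr0 mulr_ge0.
have := WM _ (imageP ree Ww) (`|f : V|^-1 *: (f : V)).
rewrite normrZ normfV normr_id mulVf// => /(_ (lexx _)).
rewrite /ree realify_scaleE linearZ/= re_of_realM normrM normfV normr_id.
rewrite mulrC ler_pdivrMr ?lt0r ?f0 ?normr_ge0// => /le_trans; apply.
by rewrite ler_wpM2r// ler_norm.
Qed.

End real_functionals.

(** * Weak topologies, canonical embeddings and adjoints *)

Lemma initial_cvgP (S : choiceType) (T : topologicalType) (f : S -> T)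
    (F : set_system S) (s : S) : Filter F ->
  F --> (s : initial_topology f) <-> f @ F --> f s.
Proof.
move=> FF; split=> [Fs|Ffs A].
  exact: cvg_comp Fs (@initial_continuous S T f s).
rewrite nbhsE => -[B [+ Bs] BA] => -[U oU UB]; apply: filterS BA _.
rewrite -UB; apply: Ffs; apply: open_nbhs_nbhs; split=> //.
by rewrite -UB in Bs.
Qed.

Section dual_spaces.
Context (R : realType) (k : scalar_kind).
Local Notation K := (scalars R k).
Implicit Types E F : normedModType K.

Lemma weak_cvgP E (F : set_system E) (x : E) : Filter F ->
  F --> (x : weak E) <-> forall f : dual E, f y @[y --> F] --> f x.
Proof. by move=> FF; rewrite initial_cvgP pointwise_cvgP. Qed.

Lemma weakstar_cvgP E (F : set_system (dual E)) (f : dual E) : Filter F ->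
  F --> (f : weakstar E) <-> forall x : E, g x @[g --> F] --> f x.
Proof. by move=> FF; rewrite initial_cvgP pointwise_cvgP. Qed.

(** The order of [K] is only partial for complex scalars, so the limit is compared on real parts, up
    to any real [e > 0]. *)
Lemma norm_cvg_le (I : Type) (F : set_system I) (f : I -> K) (r M : K) :
  ProperFilter F -> (forall i, `|f i| <= M) -> f @ F --> r -> `|r| <= M.
Proof.
move=> FF fM /cvgrPdist_le fr.
have [i0 _] := @filter_ex _ F _ _ filterT.
have M0 : 0 <= M by exact: le_trans (fM i0).
rewrite -[leLHS]ge0_reK// -[leRHS]ge0_reK// ler_of_real.
apply/ler_addgt0Pr => e e0.
have e0' : 0 < of_real e :> K by rewrite -(rmorph0 of_real) ltr_of_real.
have [i ri] := filter_ex (fr _ e0').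
rewrite -[X in _ + X](of_realK k) -raddfD; apply: ler_re.
by rewrite -(subrK (f i) r) (le_trans (ler_normD _ _))// addrC lerD.
Qed.

Lemma blin_continuous E F (T : blin E F) : continuous T.
Proof.
move=> x; apply/cvgrPdist_le => e e0.
have [M [M0 TM]] := blin_bounded T.
have M1 : 0 < M + 1 by rewrite ltr_wpDl.
near=> y; rewrite -linearB; apply: le_trans (TM _) _.
apply: (@le_trans _ _ ((M + 1) * `|x - y|)).
  by rewrite ler_wpM2r// lerDl.
rewrite -ler_pdivlMl//; near: y.
by apply: cvgr_dist_le => //; rewrite mulr_gt0// invr_gt0.
Unshelve. all: by end_near. Qed.

(** Hahn-Banach extends [c *: x + y |-> c], for [y] in [S], which the distance [d] bounds by
    [d^-1]. *)
Lemma separate_from_subspace E (S : set E) (x : E) (d : K) : 0 < d ->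
  S !=set0 -> (forall c y z, S y -> S z -> S (c *: y + z)) ->
  (forall y, S y -> d <= `|x - y|) ->
  exists f : dual E, (forall y, S y -> f y = 0) /\ f x = 1.
Proof.
move=> d0 [s Ss] Slin Sd.
have S0 : S 0 by have := Slin (-1) _ _ Ss Ss; rewrite scaleN1r addNr.
have SZ c y : S y -> S (c *: y) by move=> Sy; rewrite -[_ *: _]addr0; exact: Slin.
pose G := [set u : E * K | exists2 y, S y & u.1 = u.2 *: x + y].
have [|||[_ c] [y Sy /= ->]|f [fG _]] := @hahn_banach _ _ _ G d^-1.
- by rewrite invr_ge0 ltW.
- by exists (0, 0), 0 => //=; rewrite scale0r addr0.
- move=> c u v [y Sy uy] [z Sz vz]; exists (c *: y + z); first exact: Slin.
  by rewrite /= uy vz scalerDr scalerA scalerDl addrACA.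
- have [->|c0] := eqVneq c 0; first by rewrite normr0 mulr_ge0// invr_ge0 ltW.
  have -> : c *: x + y = c *: (x - (- c^-1) *: y).
    by rewrite scalerBr scalerA mulrN divff// scaleN1r opprK.
  rewrite normrZ mulrCA ler_peMr// -ler_pdivrMl ?invr_gt0// invrK mulr1.
  by apply: Sd; exact: SZ.
exists f; split=> [y Sy|].
  by apply: (fG (y, 0)); exists y => //=; rewrite scale0r add0r.
by apply: (fG (x, 1)); exists 0 => //=; rewrite scale1r addr0.
Qed.

(** The lower bound uses a functional of norm at most 1 with value [|x|] at [x], extended from the
    span of [x]. *)
Lemma norm_ev E (x : E) : `|ev x| = `|x|.
Proof.
apply/eqP; rewrite eq_le; apply/andP; split.
  by apply: normr_blin_le => // f; exact: (ev_subproof x).2.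
pose G := [set u : E * K | exists c, u = (c *: x, c * `|x|)].
have [|c _ _ [a ->] [b ->]|_ [c ->]|f [fG f1]] := @hahn_banach _ _ _ G 1 ler01.
- by exists (1 *: x, 1 * `|x|), 1.
- by exists (c * a + b); rewrite /= scalerDl scalerA mulrDl mulrA.
- by rewrite /= mul1r normrM normrZ normr_id.
have fx : f x = `|x|.
  by apply: (fG (x, `|x|)); exists 1; rewrite scale1r mul1r.
rewrite -[leLHS]normr_id -fx; apply: le_trans (ler_norm_blin (ev x) f) _.
by rewrite ler_piMr.
Qed.

Lemma ev_linear E : linear (@ev R k E).
Proof. by move=> c x y; apply: blinP => f /=; rewrite linearP. Qed.

(** The isometric image of a complete space is closed: at distance 0, the [y] with [ev y] close to
    [x] generate a Cauchy filter, whose limit is sent to [x]. *)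
Lemma dist_ev_gt0 (E : completeNormedModType K) (x : dual (dual E)) :
  ~ (exists y : E, ev y = x) ->
  exists2 d : K, 0 < d & forall y : E, d <= `|x - ev y|.
Proof.
move=> nx; apply: contrapT => nd.
have evB (y z : E) : ev y - ev z = ev (y - z).
  by apply: blinP => f; rewrite /= linearB.
have near_x (e : R) : 0 < e -> exists y : E, `|x - ev y| < of_real e.
  move=> e0; apply: contrapT => ne; apply: nd.
  have e0' : 0 < of_real e :> K by rewrite -(rmorph0 of_real) ltr_of_real.
  exists (of_real e) => // y; rewrite real_leNgt ?normr_real ?gtr0_real//.
  by apply/negP => xy; apply: ne; exists y.
pose B (e : R) := [set y : E | `|x - ev y| < of_real e].
pose F := filter_from [set e : R | 0 < e] B.
have FF : ProperFilter F.
  apply: filter_from_proper => [|e /near_x[y xy]]; last by exists y.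
  apply: filter_from_filter => [|e d e0 d0]; first by exists 1 => /=.
  exists (Num.min e d) => [|y]; first by rewrite /= lt_min; apply/andP.
  by rewrite /B/= => xy; split; apply: lt_le_trans xy _;
    rewrite ler_of_real ge_min lexx ?orbT.
have Fc : cauchy F.
  apply: cauchy_exP => e e0.
  have e2 : 0 < re e / 2.
    by rewrite divr_gt0// -(ltr_of_real k) rmorph0 ge0_reK// ltW.
  have [y xy] := near_x _ e2; exists y; exists (re e / 2) => // z xz.
  rewrite -ball_normE/= -norm_ev -evB -(subrK x (ev y)) -addrA.
  apply: le_lt_trans (ler_normD _ _) _; rewrite distrC.
  have -> : e = of_real (re e / 2) + of_real (re e / 2).
    by rewrite -rmorphD/= -splitr ge0_reK// ltW.
  exact: ltrD.
have [y Fy] : exists y : E, F --> y by apply/cvg_ex; exact: cauchy_cvg.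
apply: nx; exists y; apply/eqP; rewrite eq_sym -subr_eq0 -normr_le0.
rewrite -[leLHS]ge0_reK// -(rmorph0 of_real) ler_of_real.
apply/ler_addgt0Pr => e e0; rewrite add0r -(ler_of_real k) ge0_reK//.
have e2 : 0 < e / 2 by rewrite divr_gt0.
have e2' : 0 < of_real (e / 2) :> K by rewrite -(rmorph0 of_real) ltr_of_real.
have /fcvgrPdist_lt/(_ _ e2') := Fy.
move=> yF.
have xF : F (B (e / 2)) by exists (e / 2).
have [z [/= yz xz]] := filter_ex (filterI yF xF).
rewrite -(subrK (ev z) x) -addrA; apply: le_trans (ler_normD _ _) _.
rewrite (splitr e) rmorphD/=; apply: lerD; first exact: ltW.
by rewrite evB norm_ev distrC ltW.
Qed.

(** Otherwise some [phi] in the third dual vanishes on the image of [E] but not at [x]. As [phi] is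
    [ev f], this [f] vanishes on [E], so [phi] is 0. *)
Lemma reflexive_space_predual (E : completeNormedModType K) :
  reflexive_space (dual E) -> reflexive_space E.
Proof.
move=> rdE x; apply: contrapT => nx.
have [d d0 xd] := dist_ev_gt0 nx.
have [||_ [y _ <-]|phi [phi0 phix]] := @separate_from_subspace _ (range (@ev R k E)) x d d0.
- by exists (ev 0), 0.
- move=> c _ _ [y _ <-] [z _ <-]; exists (c *: y + z) => //; exact: ev_linear.
- exact: xd.
have [f fphi] := rdE phi.
have f0 : f = 0.
  by apply: blinP => y; rewrite -[RHS](phi0 (ev y)) ?fphi -?fphi//; exists y.
by move: phix; rewrite -fphi f0 /= linear0 => /eqP; rewrite eq_sym oner_eq0.
Qed.

(** Every functional is some [T x], where [w] takes the value [adjoint T w x]; so the [w] with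
    [|adjoint T w| <= 1] are pointwise bounded, hence bounded in norm. *)
Lemma adjoint_bounded_below E F (T : blin E (dual F)) :
  (forall f : dual F, exists x, T x = f) ->
  exists2 C : K, 0 <= C & forall w : dual (dual F), `|w| <= C * `|adjoint T w|.
Proof.
move=> Tonto.
have [f|M [M0 WM]] := @uniform_boundedness _ _ _ [set w | `|adjoint T w| <= 1].
  have [x <-] := Tonto f; exists (re `|x|) => w /= w1; rewrite ge0_reK//.
  apply: le_trans (ler_norm_blin (adjoint T w) x) _.
  by rewrite ler_piMl.
exists (of_real M) => [|w]; first by rewrite -(rmorph0 of_real) ler_of_real.
have [v0|v0] := eqVneq (adjoint T w) 0.
  rewrite v0 normr0 mulr0 normr_le0; apply/eqP/blinP => f.
  have [x <-] := Tonto f; exact: (congr1 (fun v : dual E => v x) v0).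
have vgt0 : 0 < `|adjoint T w| by rewrite normr_gt0.
have : `| `|adjoint T w|^-1 *: w| <= of_real M.
  apply: WM; rewrite /mkset linearZ [X in X <= _]normrZ normfV normr_id.
  by rewrite mulVf// gt_eqF.
by rewrite normrZ normfV normr_id mulrC ler_pdivrMr.
Qed.

(** The lower bound for [adjoint T] makes [adjoint T w |-> phi w] bounded on the range of
    [adjoint T]; its extension to the whole dual is the preimage [y]. *)
Lemma biadjoint_onto E F (T : blin E (dual F)) :
  (forall f : dual F, exists x, T x = f) ->
  forall phi : dual (dual (dual F)), exists y, adjoint (adjoint T) y = phi.
Proof.
move=> /adjoint_bounded_below[C C0 TC] phi.
pose G := [set (adjoint T w, phi w) | w in [set: dual (dual F)]].
have [|||_ [w _ <-]|y [yG _]] := @hahn_banach _ _ (dual E) G (`|phi| * C).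
- by rewrite mulr_ge0.
- by exists (adjoint T 0, phi 0), 0.
- move=> c _ _ [w _ <-] [v _ <-]; exists (c *: w + v) => //.
  by rewrite !linearP.
- rewrite -mulrA; apply: le_trans (ler_norm_blin _ _) _.
  by apply: ler_wpM2l => //; exact: TC.
by exists y; apply: blinP => w; apply: (yG (adjoint T w, phi w)); exists w.
Qed.

End dual_spaces.

(** * Weak*-to-weak continuity of the first Arens product, and regularity *)

Section arens.
Context (R : realType) (k : scalar_kind).
Local Notation K := (scalars R k).
Context (A : normedAlgType K).

(** The conclusion expresses weak*-to-weak continuity of [x |-> z ** x]: the weak*-continuous
    functionals are the evaluations. *)
Lemma biadjoint_derivation_weakstar_weak (D : blin A (dual A)) :
  (forall f : dual A, exists a : A, D a = f) ->
  derivation (adjoint (adjoint D)) ->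
  forall (phi : dual (dual (dual A))) (z : dual (dual A)),
  exists g : dual A, forall x, phi (z ** x) = x g.
Proof.
move=> Donto dD phi z.
have [y <-] := biadjoint_onto Donto phi.
(* This [g] comes from solving [dDz] for its term in [z ** x]; the other two terms are values of
   [x]. *)
exists (biactl y (adjoint D z) - adjoint D (y ** z)) => x.
have dDz : (x ** y) (adjoint D z) =
    y (adjoint D (z ** x)) + x (adjoint D (y ** z)).
  by have := congr1 (fun w : dual (dual (dual A)) => w z) (dD x y).
rewrite linearB; apply/esym/eqP; rewrite subr_eq; exact/eqP.
Qed.

Hypothesis wstarweak : forall (phi : dual (dual (dual A))) (z : dual (dual A)),
  exists g : dual A, forall x, phi (z ** x) = x g.

Lemma arens_regular_weakstar_weak : arens_regular A.
Proof.
move=> z x; apply: blinP => f.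
have [g zg] := wstarweak (ev f) z.
have -> : arens1 z x f = x g by exact: zg.
(* Taking [ev a] for [x] identifies [g] with [biactr f z], since [biactl (ev a) f] is
   [dactl a f]. *)
congr (x _); apply: blinP => a; rewrite -[LHS](zg (ev a)).
by congr (z _); exact: blinP.
Qed.

End arens.

(** * Consequences of Arens regularity, and approximate identities *)

Section arens_regular.
Context (R : realType) (k : scalar_kind).
Local Notation K := (scalars R k).
Context (A : normedAlgType K).

(** For [w] in the second dual, [w (dactr f (a i))] is [ev (a i)] at [biactl w f], and
    [w (dactl (a i) f)] is [ev (a i)] at [biactr f w]. Regularity identifies the weak* limits with
    the required values. *)
Lemma arens_regular_wstarwc : arens_regular A -> dual_wstarwc A.
Proof.
move=> reg; split=> [f x|f x I a /weakstar_cvgP ax].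
  exists (biactr f x); split=> [|I a /weakstar_cvgP ax].
    by apply: blinP => w; exact: esym (congr1 (fun v : dual (dual A) => v f) (reg x w)).
  apply/weak_cvgP => w.
  rewrite -[w (biactr f x)]/(arens2 x w f) -reg; exact: ax (biactl w f).
apply/weak_cvgP => w.
rewrite -[w (biactl x f)]/(arens1 w x f) reg; exact: ax (biactr f w).
Qed.

(* A cluster point of the approximate identity would do; Hahn-Banach replaces
   the weak* compactness of balls. *)
Lemma left_bai_arens_unit : left_bai A ->
  exists e : dual (dual A), forall a f, e (dactl a f) = f a.
Proof.
move=> [I [e [[M eM] ea]]].
have [i0] := dir_inhabited I.
have M0 : 0 <= M by exact: le_trans (eM i0).
(* The graph of the limit functional, on the subspace of those [f] for which [f (e i)] converges. *)
pose G := [set u : dual A * K | u.1 (e i) @[i --> tails I] --> u.2].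
have [|c u v Gu Gv|u Gu|E [EG _]] := @hahn_banach _ _ (dual A) G M M0.
- exists (0, 0); exact: cvg_cst.
- by apply: cvgD Gv; apply: cvgM Gu; exact: cvg_cst.
- apply: norm_cvg_le Gu => i; apply: le_trans (ler_norm_blin _ _) _.
  by rewrite mulrC ler_wpM2r.
exists E => a f; apply: (EG (_, _)).
exact: continuous_cvg (@blin_continuous _ _ _ _ f a) (ea a).
Qed.

End arens_regular.

Theorem mainTheorem5 (R : realType) (k : scalar_kind)
    (A : banachAlgType (scalars R k)) (D : blin A (dual A)) :
  derivation D ->
  (forall f : dual A, exists a : A, D a = f) ->
  derivation (adjoint (adjoint D)) ->
  [/\ dual_wstarwc A /\ bidual_Lwstarwc A,
      forall x : dual (dual A),
        continuous ((fun y => x ** y) :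
          weakstar (dual A) -> weak (dual (dual A))),
      arens_regular A
    & left_bai A -> reflexive_space A].
Proof.
move=> _ Donto dD.
have wsw := biadjoint_derivation_weakstar_weak Donto dD.
have reg := arens_regular_weakstar_weak wsw.
split=> //.
- split; first exact: arens_regular_wstarwc.
  move=> y x I a /weakstar_cvgP ax; apply/weak_cvgP => phi.
  have [g phig] := wsw phi y.
  suff : phi (y ** ev (a i)) @[i --> tails I] --> phi (y ** x) by [].
  by rewrite phig; under eq_fun do rewrite phig; exact: ax.
- move=> x y; have Fy := nbhs_filter (y : weakstar (dual A)).
  apply/(weak_cvgP _ (fmap_filter (fun w : dual (dual A) => x ** w) Fy)) => phi.
  have [g phig] := wsw phi x.
  suff : phi (x ** w) @[w --> (y : weakstar (dual A))] --> phi (x ** y) by [].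
  rewrite phig; under eq_fun do rewrite phig.
  exact: (weakstar_cvgP y Fy).1 cvg_id g.
move=> /left_bai_arens_unit[e eE]; apply: reflexive_space_predual => phi.
have [g phig] := wsw phi e; exists g; apply: blinP => x.
(* By its construction [e] is a left unit for the second product, and regularity carries this over
   to the first. *)
have ex : e ** x = x.
  apply: blinP => f; rewrite -[LHS]/(arens1 e x f) reg; congr (x _).
  by apply: blinP => a; exact: eE.
by rewrite -[in RHS]ex phig.
Qed.
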